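(* Let $m\ge 2$, $D\ge 0$, $n\ge 1$, $\beta\in(0,1)$, let $x=x_{-D+1}^n$ be a real-valued time series, and let $Q:\mathbb R\to A=\{0,\dots,m-1\}$ be a quantiser. Consider the Bayesian Context Trees State Space Model with arbitrary parametric models at the contexts, the tree prior $\pi(T)=\pi_D(T;\beta)$ on $\mathcal T(D)$, and independent parameter priors $\pi(\theta\mid T)=\prod_{s\in T}\pi(\theta_s)$. Let $T_{\rm MAX}$ be the tree built from the discrete contexts of $x$ and, for the nodes $s$ of $T_{\rm MAX}$, define recursively from the leaves to the root $$P_{m,s}=\begin{cases}P_e(s,x), & \text{if } s \text{ is a leaf of } T_{\rm MAX} \text{ at depth } D,\\ \beta, & \text{if } s \text{ is a leaf of } T_{\rm MAX} \text{ at depth} <D,\\ \max\big\{\beta P_e(s,x),\ (1-\beta)\prod_{j=0}^{m-1}P_{m,sj}\big\}, & \text{otherwise,}\end{cases}$$ where $sj$ is the concatenation of $s$ and the symbol $j$. Starting at the root and proceeding recursively with its descendants, for each (remaining, non-leaf) node $s$: if the maximum in the definition of $P_{m,s}$ is achieved by the first term $\beta P_e(s,x)$, prune all descendants of $s$ from $T_{\rm MAX}$. Let $T_1^*$ be the resulting tree. If $\beta\ge 1/2$, then $T_1^*$ is the maximum a posteriori (MAP) tree model, i.e. $T_1^*\in\mathcal T(D)$ and $$\pi(T_1^*\mid x)=\max_{T\in\mathcal T(D)}\pi(T\mid x).$$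
   Context: Notation: $x_i^j=(x_i,x_{i+1},\dots,x_j)$. The alphabet is $A=\{0,\dots,m-1\}$. The quantiser $Q:\mathbb R\to A$ is given by thresholds $c_1<\dots<c_{m-1}$: $Q(x)=0$ for $x<c_1$, $Q(x)=i$ for $x$ between $c_i$ and $c_{i+1}$ ($1\le i\le m-2$), and $Q(x)=m-1$ for $x>c_{m-1}$, with any fixed convention at the thresholds themselves. Put $y_i=Q(x_i)$. Trees: nodes of $m$-ary trees are identified with finite strings over $A$; the root is the empty string, the children of $s$ are $sj$, $j\in A$, and the depth of a node is its length. A tree is proper if every node that is not a leaf has exactly $m$ children. $\mathcal T(D)$ is the set of all proper $m$-ary trees of depth at most $D$ (including the tree consisting only of the root). A tree $T$ is identified with its set of leaves; $|T|$ is the number of leaves and $L_D(T)$ is the number of leaves at depth $D$. Tree prior: $\pi(T)=\pi_D(T;\beta)=\alpha^{|T|-1}\beta^{|T|-L_D(T)}$, where $\alpha=(1-\beta)^{1/(m-1)}$. Contexts: for $1\le i\le n$ let $t_i=(y_{i-1},y_{i-2},\dots,y_{i-D})$ (most recent symbol first). For a string $s$ of length at most $D$, $B_s$ is the set of $i\in\{1,\dots,n\}$ such that $s$ is an initial segment of $t_i$ (the first $|s|$ symbols of $t_i$ are $s$). For $T\in\mathcal T(D)$, the context (state) of $x_i$ is the unique leaf $s$ of $T$ with $i\in B_s$. Model: with each string $s$ of length at most $D$ are associated a parametric model with parameter $\theta_s$, i.e. conditional densities $p(x_i\mid T,\theta_s,x_{-D+1}^{i-1})$ for $x_i$ when its context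 is $s$ (depending on $T$ only through $s$), and a prior probability density $\pi(\theta_s)$. For $T\in\mathcal T(D)$ and $\theta=\{\theta_s: s\in T\}$ the likelihood, conditional on the initial samples $x_{-D+1}^0$, is $$p(x\mid T,\theta)=\prod_{s\in T}\ \prod_{i\in B_s}p(x_i\mid T,\theta_s,x_{-D+1}^{i-1}).$$ The posterior over trees is $\pi(T\mid x)=\pi(T)\,p(x\mid T)/p(x)$, where $p(x\mid T)=\int p(x\mid T,\theta)\pi(\theta\mid T)\,d\theta$ and $p(x)=\sum_{T\in\mathcal T(D)}\pi(T)p(x\mid T)$, assumed to satisfy $0<p(x)<\infty$. Estimated probabilities: for each string $s$ of length at most $D$, $$P_e(s,x)=\int\prod_{i\in B_s}p(x_i\mid T,\theta_s,x_{-D+1}^{i-1})\,\pi(\theta_s)\,d\theta_s,$$ assumed well defined and finite (when $B_s=\emptyset$ the product is empty and $P_e(s,x)=1$). $T_{\rm MAX}$ is the smallest proper $m$-ary tree that has all the strings $t_i$, $1\le i\le n$, as leaves; thus it may also have leaves $s$ with $B_s=\emptyset$. *)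

(* Defs.v *)
From HB Require Import structures.
From mathcomp Require Import all_boot all_order all_algebra.
From mathcomp Require Import finmap.
From mathcomp Require Import all_classical all_reals all_analysis.

Set Implicit Arguments.
Unset Strict Implicit.
Unset Printing Implicit Defensive.

Import Order.TTheory GRing.Theory Num.Theory.

Local Open Scope classical_set_scope.
Local Open Scope fset_scope.
Local Open Scope ring_scope.

Section trees.
Variable m : nat.

Definition string := seq 'I_m.

Implicit Types (T : {fset string}) (s : string).

(* A tree is encoded by its set of nodes; the children of s are the rcons s j. *)
Definition leaves T : {fset string} :=
  [fset s in T | [forall j, rcons s j \notin T]].

Definition proper_tree T : Prop :=
  [/\ [::] \in T,
      forall s j, rcons s j \in T -> s \in T
    & forall s, s \in T -> s \in leaves T \/ forall j, rcons s j \in T].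

Definition strings (D : nat) : {fset string} :=
  [fset (bseqval b : string) | b in {: D.-bseq 'I_m}].

Definition trees (D : nat) : {fset {fset string}} :=
  [fset T in fpowerset (strings D) | `[< proper_tree T >]].

Definition nleaves T : nat := #|` leaves T|.

Definition nleaves_at (D : nat) T : nat :=
  #|` [fset s in leaves T | size s == D]|.

Definition tree_prior (R : realType) (D : nat) (beta : R) T : R :=
  let alpha := (1 - beta) `^ (m.-1)%:R^-1 in
  alpha ^+ (nleaves T).-1 * beta ^+ (nleaves T - nleaves_at D T).

End trees.

(* The thresholds are c 1 < ... < c m.-1, the other values of c being
   irrelevant.  The values of Q at the thresholds are left unconstrained. *)
Definition quantiser (R : realType) (m : nat) (c : nat -> R) (Q : R -> 'I_m) :
    Prop :=
  (forall i j, (0 < i < j)%N -> (j < m)%N -> c i < c j) /\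
  forall z : R,
    [/\ z < c 1%N -> Q z = 0%N :> nat,
        forall i, (0 < i)%N -> (i.+1 < m)%N -> c i < z < c i.+1 ->
          Q z = i :> nat
      & c m.-1 < z -> Q z = m.-1 :> nat].

(* The series x_{-D+1}, ..., x_n is a (D + n)-tuple, and the time i in
   {1, ..., n} is the ordinal i - 1 : 'I_n. *)
Section contexts.
Variables (R : realType) (m D n : nat).
Variables (Q : R -> 'I_m) (x : (D + n).-tuple R).

Definition sample (i : 'I_n) : R := tnth x (rshift D i).

Definition past (i : 'I_n) : seq R := take (D + i) x.

Definition recent (u : seq R) : string m := take D (rev (map Q u)).

Definition ctx (i : 'I_n) : string m := recent (past i).

Definition B (s : string m) : {set 'I_n} := [set i | prefix s (ctx i)].

(* inclusion of node sets gives the order for which T_MAX is smallest *)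
Definition is_TMAX (T : {fset string m}) : Prop :=
  [/\ proper_tree T,
      forall i, ctx i \in leaves T
    & forall T', proper_tree T' -> (forall i, ctx i \in leaves T') ->
        T `<=` T'].

End contexts.
Arguments recent {R m} D Q u.

Lemma in_strings m D (s : string m) : (s \in strings m D) = (size s <= D)%N.
Proof.
apply/imfsetP/idP => /= [[b _ ->]|h]; first exact: size_bseq.
by exists (Bseq h).
Qed.

Lemma leavesP m (T : {fset string m}) s :
  s \in leaves T <-> s \in T /\ forall j, rcons s j \notin T.
Proof. by rewrite !inE; split=> [/andP[? /forallP]|[? /forallP ?]] //; apply/andP. Qed.

Lemma size_ctx (R : realType) m D n (Q : R -> 'I_m) (x : (D + n).-tuple R) i :
  size (ctx Q x i) = D.
Proof.
rewrite /ctx /recent size_takel// size_rev size_map /past size_takel ?leq_addr//.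
by rewrite size_tuple leq_add2l ltnW.
Qed.

Lemma TMAX_exists (R : realType) m D n (Q : R -> 'I_m) (x : (D + n).-tuple R) :
  exists T, is_TMAX Q x T.
Proof.
pose P (s : string m) := (s == [::]) || [exists i, prefix (take (size s).-1 s) (ctx Q x i)].
pose T := [fset s in strings m D | P s].
have inT s : s \in T = (size s <= D)%N && P s.
  by rewrite !inE/= in_strings.
have Pr s j : P (rcons s j) = [exists i, prefix s (ctx Q x i)].
  rewrite /P size_rcons/= -cats1 take_size_cat//.
  by case: s.
exists T; split.
- split; first by rewrite inT.
  + move=> s j; rewrite !inT Pr size_rcons => /andP[sD /existsP[i si]].
    rewrite (ltnW sD)/=; apply/orP; right; apply/existsP; exists i.
    by apply: prefix_trans si; rewrite prefix_take.
  + move=> s sT; have [/existsP[i si]|/existsPn h] := boolP [exists i, prefix s (ctx Q x i)].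
      have [sD|sD] := ltnP (size s) D.
        by right=> j; rewrite inT size_rcons sD Pr; apply/existsP; exists i.
      by left; apply/leavesP; split=> // j; rewrite inT size_rcons ltnNge sD.
    left; apply/leavesP; split=> // j; rewrite inT Pr negb_and orbC.
    by apply/orP; left; apply/existsPn.
- move=> i; apply/leavesP; split.
    rewrite inT size_ctx leqnn/=; apply/orP; right; apply/existsP; exists i.
    by rewrite prefix_take.
  by move=> j; rewrite inT size_rcons size_ctx ltnn.
- move=> T' [T0 Tp Tc] hT'; apply/fsubsetP => s; rewrite inT.
  case: (lastP s) => // u j; rewrite Pr size_rcons => /andP[uD /existsP[i /prefixP[w hw]]].
  have pre v v' : v ++ v' \in T' -> v \in T'.
    elim/last_ind: v' => [|v' k IH]; first by rewrite cats0.
    by rewrite -rcons_cat => /Tp.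
  case: w hw => [|k w] hw.
    by move: uD; rewrite -(size_ctx Q x i) hw cats0 ltnn.
  have ukT : rcons u k \in T'.
    apply: (pre _ w); rewrite cat_rcons -hw.
    by have /leavesP[] := hT' i.
  have [/leavesP[_ /(_ k)]|//] := Tc u (Tp _ _ ukT).
  by rewrite ukT.
Qed.

Definition is_density (R : realType) d (X : measurableType d)
    (mu : set X -> \bar R) (f : X -> R) : Prop :=
  [/\ forall z, 0 <= f z, measurable_fun setT f
    & (\int[mu]_z (f z)%:E = 1)%E].

(* The parametric models at the contexts: theta_s ranges over the measurable
   space par s, with reference measure dtheta_s = parmu s;
   cond s theta u z is the density at z of the next sample, given that the
   samples observed so far are u, and par_prior s is the density of theta_s. *)
Record ctx_models (R : realType) (m : nat) := CtxModels {
  par_disp : string m -> measure_display ;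
  par : forall s, measurableType (par_disp s) ;
  parmu : forall s, {sigma_finite_measure set (par s) -> \bar R} ;
  cond : forall s, par s -> seq R -> R -> R ;
  par_prior : forall s, par s -> R }.

Definition valid_models (R : realType) (m D : nat) (Q : R -> 'I_m)
    (M : ctx_models R m) : Prop :=
  forall s : string m, (size s <= D)%N ->
    is_density (parmu M s) (@par_prior _ _ M s) /\
    forall u : seq R, (D <= size u)%N -> prefix s (recent D Q u) ->
      (forall th, is_density lebesgue_measure (@cond _ _ M s th u)) /\
      (forall z, measurable_fun setT (fun th => @cond _ _ M s th u z)).

(* The library's instance making \x sigma-finite is shadowed by the one for
   probability measures, hence a named copy of \x carrying it. *)
Section sigma_finite_product.
Local Open Scope ereal_scope.
Context d1 d2 (X : measurableType d1) (Y : measurableType d2) (R : realType).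
Variables (mu : {sigma_finite_measure set X -> \bar R}).
Variables (nu : {sigma_finite_measure set Y -> \bar R}).

Definition sfprod : set (X * Y) -> \bar R := mu \x nu.

HB.instance Definition _ := Measure.copy sfprod (mu \x nu).

Lemma sfprod_sigma_finite : sigma_finite setT sfprod.
Proof.
have /sigma_finiteP[F [TF ndF Foo]] := sigma_finiteT mu.
have /sigma_finiteP[G [TG ndG Goo]] := sigma_finiteT nu.
exists (fun k => setX (F k) (G k)).
  rewrite -setXTT TF TG; apply/seteqP; split=> [[y z] [[i _ /= Fy] [j _ Gz]]|].
    exists (maxn i j) => //; split=> /=.
    - by move: y Fy; exact/subsetPset/ndF/leq_maxl.
    - by move: z Gz; exact/subsetPset/ndG/leq_maxr.
  by move=> [y z] [k _ [/= Fy Gz]]; split; exists k.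
move=> k; have [mF Flt] := Foo k; have [mG Glt] := Goo k.
split; first exact: measurableX.
by rewrite /sfprod product_measure1E// lte_mul_pinfty// ge0_fin_numE.
Qed.

HB.instance Definition _ :=
  Measure_isSigmaFinite.Build _ _ _ sfprod sfprod_sigma_finite.

End sigma_finite_product.

(* The space of the theta = {theta_s : s in l}, as a nested product, with the
   product of the measures dtheta_s. *)
Section parameters.
Variables (R : realType) (m : nat) (M : ctx_models R m).

Fixpoint pars_disp (l : seq (string m)) : measure_display :=
  if l is s :: l' then measure_prod_display (par_disp M s, pars_disp l')
  else default_measure_display.

Fixpoint pars (l : seq (string m)) : measurableType (pars_disp l) :=
  if l is s :: l' then (par M s * pars l')%type else unit.

Fixpoint parsmu (l : seq (string m)) :
    {sigma_finite_measure set (pars l) -> \bar R} :=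
  if l is s :: l' then sfprod (parmu M s) (parsmu l') else dirac tt.

(* \prod_(s <- l) f s theta_s *)
Fixpoint prod_pars (f : forall s, par M s -> R) (l : seq (string m)) :
    pars l -> R :=
  if l is s :: l' then fun th => f s th.1 * prod_pars f th.2 else fun=> 1.

End parameters.

Section inference.
Variables (R : realType) (m D n : nat) (beta : R).
Variables (Q : R -> 'I_m) (x : (D + n).-tuple R) (M : ctx_models R m).

Definition ctx_lik (s : string m) (th : par M s) : R :=
  \prod_(i in B Q x s) cond th (past x i) (sample x i).

Definition lik (T : {fset string m}) (th : pars M (leaves T)) : R :=
  prod_pars ctx_lik th.

Definition pars_prior (T : {fset string m}) (th : pars M (leaves T)) : R :=
  prod_pars (@par_prior _ _ M) th.

Definition marg_lik (T : {fset string m}) : \bar R :=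
  (\int[parsmu M (leaves T)]_th (lik th * pars_prior th)%:E)%E.

Definition evidence : \bar R :=
  (\sum_(T <- trees m D) (tree_prior D beta T)%:E * marg_lik T)%E.

Definition posterior (T : {fset string m}) : \bar R :=
  ((tree_prior D beta T)%:E * marg_lik T / evidence)%E.

Definition Pe (s : string m) : \bar R :=
  (\int[parmu M s]_th (ctx_lik th * par_prior th)%:E)%E.

(* k bounds the height of Tmax below s, so that the value 0 is never used
   when k = D - size s *)
Fixpoint Pm_rec (Tmax : {fset string m}) (k : nat) (s : string m) : \bar R :=
  if s \in leaves Tmax then (if size s == D then Pe s else beta%:E)
  else if k is k'.+1 then
    maxe (beta%:E * Pe s)%E
         ((1 - beta)%:E * \prod_(j < m) Pm_rec Tmax k' (rcons s j))%E
  else 0%E.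

Definition Pm (Tmax : {fset string m}) (s : string m) : \bar R :=
  Pm_rec Tmax (D - size s) s.

(* T is the current tree and s the node being visited *)
Fixpoint prune (Tmax : {fset string m}) (k : nat) (s : string m)
    (T : {fset string m}) : {fset string m} :=
  if k is k'.+1 then
    if s \in leaves T then T
    else if Pm Tmax s == (beta%:E * Pe s)%E then
      [fset u in T | ~~ (prefix s u && (u != s))]
    else foldl (fun T' j => prune Tmax k' (rcons s j) T') T (enum 'I_m)
  else T.

Definition T1 (Tmax : {fset string m}) : {fset string m} :=
  prune Tmax D [::] Tmax.

End inference.

(* Main.v *)
(** A tree prior times its marginal likelihood factorises over the tree: by
    Tonelli the marginal likelihood is the product of the [Pe s] over the
    leaves, and since [alpha ^+ (m - 1) = 1 - beta] and every internal node adds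
    [m - 1] leaves, the prior is a product of a factor [1 - beta] per internal
    node and a factor [beta] per leaf at depth less than [D].  Maximising such a
    product is a dynamic programme on the full tree, whose optimum the pruning
    attains.  Below a leaf of T_MAX of depth less than [D] all [Pe] are 1, and
    there [1 - beta <= beta] makes not splitting optimal, so the programme can
    stop at T_MAX. *)
Require Import Defs.
From HB Require Import structures.
From mathcomp Require Import all_boot all_order all_algebra.
From mathcomp Require Import finmap.
From mathcomp Require Import all_classical all_reals all_analysis.
From mathcomp Require Import measurable_realfun.
From mathcomp Require Import lra.

Set Implicit Arguments.
Unset Strict Implicit.
Unset Printing Implicit Defensive.

Import Order.TTheory GRing.Theory Num.Theory.
Local Open Scope ring_scope.

(** * Marginal likelihood as a product of estimated probabilities *)

Section marginal_likelihood.
Variables (R : realType) (m : nat) (M : ctx_models R m).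

Lemma prod_parsM (f g : forall s, par M s -> R) l (th : pars M l) :
  prod_pars f th * prod_pars g th = prod_pars (fun s t => f s t * g s t) th.
Proof. by elim: l th => [|s l IH] th /=; rewrite ?mulr1// mulrACA IH. Qed.

Lemma prod_pars_ge0 (h : forall s, par M s -> R) l (th : pars M l) :
  (forall s, s \in l -> forall t, 0 <= h s t) -> 0 <= prod_pars h th.
Proof.
elim: l th => [|s l IH] th hl //=; apply: mulr_ge0; first exact/hl/mem_head.
by apply: IH => u ul; apply: hl; rewrite in_cons ul orbT.
Qed.

Lemma measurable_prod_pars (h : forall s, par M s -> R) l :
  (forall s, s \in l -> measurable_fun setT (h s)) ->
  measurable_fun setT (fun th : pars M l => prod_pars h th).
Proof.
elim: l => [|s l IH] hl //=.
apply: measurable_funM.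
  by apply: measurableT_comp; [exact/hl/mem_head|exact: measurable_fst].
apply: (@measurableT_comp _ _ _ _ _ _ (fun th : pars M l => prod_pars h th)).
  by apply: IH => u ul; apply: hl; rewrite in_cons ul orbT.
exact: measurable_snd.
Qed.

(** Tonelli splits off the first parameter; the integral over the remaining ones is then a constant
    that leaves the integral. Nonnegativity suffices, so no integrability is required. *)
Lemma integral_prod_pars (h : forall s, par M s -> R) l :
  (forall s, s \in l -> forall t, 0 <= h s t) ->
  (forall s, s \in l -> measurable_fun setT (h s)) ->
  (\int[parsmu M l]_th (prod_pars h th)%:E =
   \prod_(s <- l) \int[parmu M s]_t (h s t)%:E)%E.
Proof.
elim: l => [|s l IH] h0 mh.
  by rewrite big_nil /= integral_dirac// diracT mul1e.
have sl : s \in s :: l by exact: mem_head.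
have ll u : u \in l -> u \in s :: l by move=> ul; rewrite in_cons ul orbT.
rewrite big_cons -IH; [|by move=> u /ll/h0|by move=> u /ll/mh].
rewrite [LHS](@fubini_tonelli1 _ _ _ _ R (parmu M s) (parsmu M l)
  (fun th : pars M (s :: l) => (prod_pars h th)%:E)); last 2 first.
- by apply/measurable_EFinP; exact: (@measurable_prod_pars h (s :: l)).
- by move=> th; rewrite lee_fin; exact: (@prod_pars_ge0 h (s :: l)).
rewrite -ge0_integralZr//; last 3 first.
- by apply/measurable_EFinP; exact: mh.
- by move=> t _; rewrite lee_fin; exact: h0.
- by apply: integral_ge0 => th _; rewrite lee_fin; apply: prod_pars_ge0 => u /ll/h0.
apply: eq_integral => t _; rewrite /fubini_F /=.
under eq_integral do rewrite EFinM.
rewrite ge0_integralZl//.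
- by apply/measurable_EFinP; apply: measurable_prod_pars => u /ll/mh.
- by move=> th _; rewrite lee_fin; apply: prod_pars_ge0 => u /ll/h0.
- by rewrite lee_fin; exact: h0.
Qed.

Variables (D n : nat) (Q : R -> 'I_m) (x : (D + n).-tuple R).
Hypothesis hM : valid_models D Q M.

Lemma size_past i : (D <= size (past x i))%N.
Proof. by rewrite size_takel ?leq_addr// size_tuple leq_add2l ltnW. Qed.

Lemma lik_prior_ge0 s (t : par M s) : (size s <= D)%N ->
  0 <= ctx_lik Q x t * par_prior t.
Proof.
move=> /hM[[p0 _ _] hc]; apply: mulr_ge0 => //.
apply: prodr_ge0 => i; rewrite inE => si.
by have [/(_ t)[]] := hc _ (size_past i) si.
Qed.

Lemma measurable_lik_prior s : (size s <= D)%N ->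
  measurable_fun setT (fun t : par M s => ctx_lik Q x t * par_prior t).
Proof.
move=> /hM[[_ mp _] hc]; apply: measurable_funM => //.
rewrite /ctx_lik; under eq_fun do rewrite -big_enum /=.
apply: measurable_prod => i; rewrite mem_enum inE => si.
by have [_] := hc _ (size_past i) si; exact.
Qed.

Lemma Pe_ge0 s : (size s <= D)%N -> (0 <= Pe Q x M s)%E.
Proof.
by move=> sD; apply: integral_ge0 => t _; rewrite lee_fin lik_prior_ge0.
Qed.

(** The likelihood at [s] is an empty product, which leaves the integral of the prior density. *)
Lemma Pe_unvisited s : (size s <= D)%N -> B Q x s = finset.set0 -> Pe Q x M s = 1%E.
Proof.
move=> /hM[[_ _ <-] _] s0; apply: eq_integral => t _.
by rewrite /ctx_lik s0 big_set0 mul1r.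
Qed.

Lemma marg_likE (T : {fset string m}) :
  (forall s, s \in T -> (size s <= D)%N) ->
  marg_lik Q x M T = (\prod_(s <- leaves T) Pe Q x M s)%E.
Proof.
move=> TD; rewrite -integral_prod_pars.
- by apply: eq_integral => th _; rewrite /lik /pars_prior prod_parsM.
- by move=> s /leavesP[/TD sD _] t; exact: lik_prior_ge0.
- by move=> s /leavesP[/TD sD _]; exact: measurable_lik_prior.
Qed.

End marginal_likelihood.

(** * Proper trees and products over their leaves *)

Section trees.
Variables (R : realType) (m D : nat).
Implicit Types (T : {fset string m}) (s u : string m).

Lemma prefix_rconsl s j u : prefix (rcons s j) u -> prefix s u.
Proof. by apply: prefix_trans; exact: prefix_rcons. Qed.

Lemma prefix_rcons_inj s i j u :
  prefix (rcons s i) u -> prefix (rcons s j) u -> i = j.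
Proof.
by rewrite !prefixE !size_rcons => /eqP-> /eqP/rcons_inj[].
Qed.

Lemma prefix_rcons_neq s u j :
  prefix s (rcons u j) -> s != rcons u j -> prefix s u.
Proof.
move=> /prefixP[w]; case/lastP: w => [|w k].
  by rewrite cats0 => ->; rewrite eqxx.
by rewrite -rcons_cat => /rcons_inj[-> _] _; exact: prefix_prefix.
Qed.

Lemma proper_tree_prefix T s u : proper_tree T -> prefix s u -> u \in T -> s \in T.
Proof.
move=> [_ Tp _] /prefixP[w ->]; elim/last_ind: w => [|w k IH].
  by rewrite cats0.
by rewrite -rcons_cat => /Tp.
Qed.

Lemma leaf_prefix T s u :
  proper_tree T -> s \in leaves T -> u \in T -> prefix s u -> u = s.
Proof.
move=> pT /leavesP[_ sl] uT /prefixP[[|k w] uE]; first by rewrite uE cats0.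
move: (sl k); rewrite (proper_tree_prefix pT _ uT)// uE -cat_rcons.
exact: prefix_prefix.
Qed.

Lemma rcons_in_tree T s j :
  proper_tree T -> s \in T -> s \notin leaves T -> rcons s j \in T.
Proof. by move=> [_ _ Tc] /Tc[->|]. Qed.

Lemma eq_leaves T T' s u :
  (forall v, prefix s v -> (v \in T) = (v \in T')) ->
  prefix s u -> (u \in leaves T) = (u \in leaves T').
Proof.
move=> e su; rewrite !inE e//; congr (_ && _); apply: eq_forallb => j.
by rewrite e// (prefix_trans su)// prefix_rcons.
Qed.

Lemma proper_strings : proper_tree (strings m D).
Proof.
split=> [|s j|s]; rewrite ?in_strings//.
  by rewrite size_rcons => /ltnW.
rewrite leq_eqVlt => /orP[/eqP sD|sD]; [left|right=> j].
  apply/leavesP; rewrite in_strings sD; split=> // j.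
  by rewrite in_strings size_rcons sD ltnn.
by rewrite in_strings size_rcons.
Qed.

Lemma in_trees T :
  T \in trees m D <-> (forall s, s \in T -> (size s <= D)%N) /\ proper_tree T.
Proof.
rewrite /trees !inE /= fpowersetE; split=> [/andP[/fsubsetP TD /asboolP ?]|[TD ?]].
  by split=> // s /TD; rewrite in_strings.
apply/andP; split; last exact/asboolP.
by apply/fsubsetP => s /TD; rewrite in_strings.
Qed.

Lemma leaf_deepest T s :
  (forall u, u \in T -> (size u <= D)%N) -> s \in T -> (D <= size s)%N ->
  s \in leaves T.
Proof.
move=> TD sT sD; apply/leavesP; split=> // j; apply/negP => /TD.
by rewrite size_rcons ltnNge sD.
Qed.

Lemma prod_leaves_leaf T s (F : string m -> R) : proper_tree T -> s \in leaves T ->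
  \prod_(u <- leaves T | prefix s u) F u = F s.
Proof.
move=> pT sl; rewrite big_mkcond (bigD1_seq s) ?fset_uniq//= prefix_refl.
rewrite big1_seq ?mulr1// => u /andP[us ul]; case: ifP => // su.
by move: us; rewrite (leaf_prefix pT sl _ su) ?eqxx//; case/leavesP: ul.
Qed.

(** A leaf with prefix [s] differs from [s], so it extends exactly one child of [s]: the leaves
    below [s] are partitioned by the children. *)
Lemma prod_leaves_node T s (F : string m -> R) : s \notin leaves T ->
  \prod_(u <- leaves T | prefix s u) F u =
  \prod_(j < m) \prod_(u <- leaves T | prefix (rcons s j) u) F u.
Proof.
move=> sl; rewrite (exchange_big_dep (prefix s))/=; last first.
  by move=> j u _; exact: prefix_rconsl.
rewrite big_seq_cond [RHS]big_seq_cond; apply: eq_bigr => u /andP[ul /prefixP[w uE]].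
case: w uE => [|k w] uE; first by move: ul; rewrite uE cats0 (negbTE sl).
rewrite (big_pred1 k)// => j /=; rewrite uE -cat_rcons.
apply/idP/eqP => [jk|->]; last exact: prefix_prefix.
exact: prefix_rcons_inj jk (prefix_prefix _ _).
Qed.

Variables (beta : R) (p : string m -> R).

(* The factor of prior times marginal likelihood contributed by the subtree of T
   rooted at s.  The fuel k is meant to be D - size s, and then the value 0 is
   never used for s in T. *)
Fixpoint weight T (k : nat) s : R :=
  if s \in leaves T then (if size s == D then p s else beta * p s)
  else if k is k'.+1 then (1 - beta) * \prod_(j < m) weight T k' (rcons s j)
  else 0.

(** Locality of [weight]: changes to the tree away from [s] and its descendants do not affect it. *)
Lemma eq_weight T T' k s :
  (forall u, prefix s u -> (u \in T) = (u \in T')) ->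
  weight T k s = weight T' k s.
Proof.
elim: k s => [|k IH] s e /=; rewrite (eq_leaves e) ?prefix_refl//.
case: ifP => // _; congr (_ * _); apply: eq_bigr => j _; apply: IH => u.
by move=> /prefix_rconsl/e.
Qed.

(** * The tree prior as a product over nodes *)

Section tree_prior.
Hypotheses (hm : (2 <= m)%N) (hbeta : 0 < beta < 1).
Let alpha := (1 - beta) `^ (m.-1)%:R^-1.

Let alpha_gt0 : 0 < alpha.
Proof. by apply: powR_gt0; rewrite subr_gt0; case/andP: hbeta. Qed.

Let alphaX : alpha ^+ m.-1 = 1 - beta.
Proof.
have m0 : m.-1%:R != 0 :> R by rewrite pnatr_eq0; case: (m) hm => [|[]].
rewrite -powR_mulrn ?powR_ge0// -powRrM mulVf// powRr1// subr_ge0 ltW//.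
by case/andP: hbeta.
Qed.

(** The extra [alpha] gives every leaf one factor [alpha]: at an internal node
    [alpha * (1 - beta) = alpha ^+ m], which hands one [alpha] to each of the [m] children. *)
Lemma weight_leaves T k s :
  T \in trees m D -> s \in T -> (size s + k = D)%N ->
  alpha * weight T k s =
  \prod_(u <- leaves T | prefix s u)
    (alpha * ((if size u == D then 1 else beta) * p u)).
Proof.
move=> /in_trees[TD pT]; elim: k s => [|k IH] s sT sD /=.
  have sl : s \in leaves T by rewrite leaf_deepest// -sD addn0.
  by rewrite sl prod_leaves_leaf// -[size s]addn0 sD eqxx mul1r.
case: ifPn => sl; first by rewrite prod_leaves_leaf//; case: ifP; rewrite ?mul1r.
rewrite prod_leaves_node// -alphaX mulrA -exprS prednK 1?ltnW//.
rewrite -[X in alpha ^+ X]card_ord -prodr_const -big_split/=.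
apply: eq_bigr => j _; rewrite IH ?size_rcons ?addSnnS//.
exact: rcons_in_tree.
Qed.

(** Following first children from the root meets a leaf by depth [D]. Positivity makes the truncated
    exponent [(nleaves T).-1] a true predecessor. *)
Lemma nleaves_gt0 T : T \in trees m D -> (0 < nleaves T)%N.
Proof.
move=> /in_trees[TD pT].
suff [u ul] : exists u, u \in leaves T.
  by rewrite /nleaves cardfs_gt0; apply/fset0Pn; exists u.
suff H k s : s \in T -> (size s + k = D)%N -> exists u, u \in leaves T.
  by case: (pT) => T0 _ _; exact: (H D [::]).
elim: k s => [|k IH] s sT sD.
  by exists s; rewrite leaf_deepest// -sD addn0.
have [|sl] := boolP (s \in leaves T); first by exists s.
apply: (IH (rcons s (Ordinal (ltnW hm)))); first exact: rcons_in_tree.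
by rewrite size_rcons addSnnS.
Qed.

Lemma tree_prior_weight T : T \in trees m D ->
  tree_prior D beta T * \prod_(s <- leaves T) p s = weight T D [::].
Proof.
move=> TT; have /in_trees[_ [T0 _ _]] := TT.
apply: (mulfI (lt0r_neq0 alpha_gt0)); rewrite weight_leaves//.
under [RHS]eq_bigl do rewrite prefix0s.
rewrite !big_split/= !mulrA; congr (_ * _).
rewrite /tree_prior /= -/alpha -exprS prednK ?nleaves_gt0//; congr (_ * _).
  by rewrite big_const_seq iter_mulr_1 count_predT.
(* The exponent of [beta] in the prior counts the leaves not at depth [D]. *)
transitivity (\prod_(u <- leaves T | size u != D) beta).
  rewrite big_const_seq iter_mulr_1; congr (_ ^+ _).
  rewrite /nleaves /nleaves_at -(count_predC (fun u => size u == D) (leaves T)).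
  rewrite [X in (_ - X)%N](_ : _ = count (fun u => size u == D) (leaves T)) ?addKn//.
  by rewrite card_fset_sum1 big_fset/= sum1_count.
by rewrite big_mkcond/=; apply: eq_bigr => u _; case: eqP.
Qed.

End tree_prior.

(** * Upper bound on the weight by dynamic programming *)

Section bounds.
Hypothesis hbeta : 0 < beta < 1.
Hypothesis p_ge0 : forall s, (size s <= D)%N -> 0 <= p s.

Lemma weight_ge0 T k s : (size s + k <= D)%N -> 0 <= weight T k s.
Proof.
case/andP: hbeta => b0 b1; elim: k s => [|k IH] s sD /=; case: ifP => // _.
- by case: ifP => _; rewrite ?mulr_ge0 ?p_ge0 ?(leq_trans _ sD) ?leq_addr// ltW.
- by case: ifP => _; rewrite ?mulr_ge0 ?p_ge0 ?(leq_trans _ sD) ?leq_addr// ltW.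
- apply: mulr_ge0; first by rewrite subr_ge0 ltW.
  by apply: prodr_ge0 => j _; apply: IH; rewrite size_rcons addSnnS.
Qed.

(* This is where beta >= 1/2 enters. *)
Lemma weight_unvisited T k s : 1 / 2 <= beta ->
  (forall u, prefix s u -> (size u <= D)%N -> p u = 1) -> (size s + k = D)%N ->
  weight T k s <= if k is 0 then 1 else beta.
Proof.
case/andP: hbeta => b0 b1 b2; elim: k s => [|k IH] s p1 sD /=.
  by rewrite -sD addn0 eqxx p1 ?prefix_refl// -?sD ?addn0//; case: ifP.
have ltD : (size s < D)%N by rewrite -sD addnS ltnS leq_addr.
rewrite (p1 s (prefix_refl s) (ltnW ltD)) mulr1 (ltn_eqF ltD); case: ifP => // _.
(* If [T] does not stop at [s], the children contribute a product at most 1, and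
   [1 - beta <= beta]. *)
apply: (@le_trans _ _ (1 - beta)); last by lra.
apply: ler_piMr; first by rewrite subr_ge0 ltW.
apply: Num.Theory.prodr_ile1 => j _.
have sjD : (size (rcons s j) + k)%N = D by rewrite size_rcons addSnnS.
rewrite weight_ge0 ?sjD//=; apply: le_trans (IH _ _ sjD) _.
  by move=> u /prefix_rconsl/p1.
by case: (k) => // _; exact: ltW.
Qed.

Variable Tmax : {fset string m}.

(** Real-valued counterpart of [Pm_rec], with [p] in place of [Pe]. *)
Fixpoint max_weight (k : nat) s : R :=
  if s \in leaves Tmax then (if size s == D then p s else beta)
  else if k is k'.+1 then
    Num.max (beta * p s) ((1 - beta) * \prod_(j < m) max_weight k' (rcons s j))
  else 0.

(** The induction descends [Tmax], while [T] is arbitrary. At an internal node of [Tmax], stopping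
    and splitting in [T] match the two terms of the maximum; below a leaf of depth less than [D],
    [weight_unvisited] takes over. *)
Lemma weight_le_max T k s : 1 / 2 <= beta ->
  Tmax \in trees m D ->
  (forall s' u, s' \in leaves Tmax -> (size s' < D)%N -> prefix s' u ->
    (size u <= D)%N -> p u = 1) ->
  s \in Tmax -> (size s + k = D)%N -> weight T k s <= max_weight k s.
Proof.
move=> b2 /in_trees[TD pT] p1; elim: k s => [|k IH] s sT sD /=.
  (* Without fuel, [s] has depth [D]; if it is not a leaf of [T], its weight is the default 0,
     bounded by [p s]. *)
  rewrite (leaf_deepest TD)// -?sD ?addn0// eqxx; case: ifP => // _.
  by rewrite p_ge0// -sD addn0.
have ltD : (size s < D)%N by rewrite -sD addnS ltnS leq_addr.
have [sl|sl] := boolP (s \in leaves Tmax).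
  have := @weight_unvisited T k.+1 s b2 (fun u => p1 s u sl ltD) sD.
  by rewrite /= (ltn_eqF ltD); case: ifP.
rewrite (ltn_eqF ltD) le_max; case: ifP => _; first by rewrite lexx.
apply/orP; right; rewrite ler_wpM2l//; first by case/andP: hbeta; lra.
apply: ler_prod => j _; have sjD : (size (rcons s j) + k)%N = D.
  by rewrite size_rcons addSnnS.
by rewrite weight_ge0 ?sjD//= IH// rcons_in_tree.
Qed.

End bounds.
End trees.

(** * Properties of T_MAX and optimality of the pruned tree *)

Section pruning.
Local Open Scope fset_scope.
Local Open Scope ring_scope.
Variables (R : realType) (m D n : nat) (beta : R).
Variables (Q : R -> 'I_m) (x : (D + n).-tuple R) (M : ctx_models R m).
Variable Tmax : {fset string m}.
Hypotheses (hm : (2 <= m)%N) (hM : valid_models D Q M).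
Hypothesis hPe : forall s : string m, (size s <= D)%N -> (Pe Q x M s < +oo)%E.
Hypothesis hTmax : is_TMAX Q x Tmax.

Let p s := fine (Pe Q x M s).

Lemma Pe_fine s : (size s <= D)%N -> Pe Q x M s = (p s)%:E.
Proof. by move=> sD; rewrite fineK// ge0_fin_numE ?hPe// Pe_ge0. Qed.

(** The full tree [strings m D] has all contexts as leaves, so minimality puts [Tmax] inside it. *)
Lemma TMAX_in_trees : Tmax \in trees m D.
Proof.
have [pT _ Tmin] := hTmax; apply/in_trees; split=> // s sT.
have /fsubsetP/(_ s sT) : Tmax `<=` strings m D; last by rewrite in_strings.
apply: Tmin => [|i]; first exact: proper_strings.
apply: (@leaf_deepest _ D); rewrite ?in_strings ?size_ctx// => s'.
by rewrite in_strings.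
Qed.

(** A context extending [s] is a node of [Tmax], hence equal to the leaf [s]; but contexts have
    length [D]. *)
Lemma TMAX_leaf_unvisited s : s \in leaves Tmax -> (size s < D)%N ->
  B Q x s = finset.set0.
Proof.
move=> sl sD; have [pT cl _] := hTmax; apply/setP => i; rewrite finset.in_set0 inE.
apply/negP => si; have /leavesP[iT _] := cl i.
by move: sD; rewrite -(leaf_prefix pT sl iT si) size_ctx ltnn.
Qed.

Lemma TMAX_leaf_p s u : s \in leaves Tmax -> (size s < D)%N -> prefix s u ->
  (size u <= D)%N -> p u = 1.
Proof.
move=> sl sD su uD; rewrite /p (Pe_unvisited hM)//.
apply/setP => i; rewrite finset.in_set0; apply/negP; rewrite inE => ui.
have : i \in B Q x s by rewrite inE (prefix_trans su).
by rewrite TMAX_leaf_unvisited// finset.in_set0.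
Qed.

Lemma Pm_rec_fine k s : (size s + k <= D)%N ->
  Pm_rec beta Q x M Tmax k s = (max_weight D beta p Tmax k s)%:E.
Proof.
elim: k s => [|k IH] s sD /=; have sD' := leq_trans (leq_addr _ _) sD.
  by rewrite Pe_fine//; do 2 case: ifP => _ //.
rewrite Pe_fine//; case: ifP => _; first by case: ifP.
rewrite EFin_max; congr maxe; rewrite EFinM -prodEFin; congr (_ * _)%E.
by apply: eq_bigr => j _; rewrite IH// size_rcons addSnnS.
Qed.

Lemma leaf_cut (T : {fset string m}) s : s \in T ->
  s \in leaves [fset u in T | ~~ (prefix s u && (u != s))].
Proof.
move=> sT; apply/leavesP; rewrite !inE sT eqxx andbF; split=> // j.
rewrite !inE prefix_rcons /= negb_and negbK; apply/orP; right.
by apply/eqP => /(congr1 size)/eqP; rewrite size_rcons (gtn_eqF (ltnSn _)).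
Qed.

Lemma proper_cut (T : {fset string m}) s : proper_tree T ->
  proper_tree [fset u in T | ~~ (prefix s u && (u != s))].
Proof.
move=> pT; have [T0 Tp Tc] := pT; set T' := [fset u in T | _].
have inT' u : (u \in T') = (u \in T) && ~~ (prefix s u && (u != s)).
  by rewrite !inE.
split.
- by rewrite inT' T0; case: (s).
- move=> u j; rewrite !inT' => /andP[/[dup] ujT /Tp ->].
  apply: contra => /andP[su us].
  rewrite (prefix_trans su) ?prefix_rcons//=; apply/eqP => uj.
  by have := size_prefix su; rewrite -uj size_rcons ltnn.
- move=> u; rewrite inT' => /andP[uT us].
  have [ul|ul] := boolP (u \in leaves T).
    left; apply/leavesP; rewrite inT' uT us; split=> // j.
    by have /leavesP[_ uc] := ul; rewrite inT' (negbTE (uc j)).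
  have [us'|us'] := eqVneq u s; first by left; rewrite us' leaf_cut// -us'.
  right=> j; rewrite inT' rcons_in_tree//=; apply: contra us => /andP[suj uj].
  by rewrite us' andbT; apply: prefix_rcons_neq suj _; rewrite eq_sym.
Qed.

(** Invariant of pruning at [s]: only strict descendants of [s] are removed, and the subtree left at
    [s] attains the optimum. *)
Let spec k s (T T' : {fset string m}) :=
  [/\ proper_tree T', forall u, u \in T' -> u \in T,
      forall u, ~~ (prefix s u && (u != s)) -> (u \in T') = (u \in T)
    & weight D beta p T' k s = max_weight D beta p Tmax k s].

(** Subtrees at distinct children are disjoint: pruning at one child leaves the later ones as in
    [Tmax], and later prunings preserve the weights already attained. The first hypothesis is the
    induction hypothesis of [prune_spec]. *)
Lemma prune_children k s l (T : {fset string m}) :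
  (forall s T, (size s + k = D)%N -> s \in T -> proper_tree T ->
    (forall u, prefix s u -> (u \in T) = (u \in Tmax)) ->
    spec k s T (prune beta Q x M Tmax k s T)) ->
  (size s + k.+1 = D)%N -> uniq l -> proper_tree T ->
  (forall j, rcons s j \in T) ->
  (forall j u, j \in l -> prefix (rcons s j) u -> (u \in T) = (u \in Tmax)) ->
  let T' := foldl (fun T' j => prune beta Q x M Tmax k (rcons s j) T') T l in
  [/\ proper_tree T', forall u, u \in T' -> u \in T,
      forall u, (forall j, j \in l -> ~~ (prefix (rcons s j) u && (u != rcons s j))) ->
        (u \in T') = (u \in T)
    & forall j, j \in l -> weight D beta p T' k (rcons s j) =
        max_weight D beta p Tmax k (rcons s j)].
Proof.
move=> IH sD; elim: l T => [|j l IHl] T //= /andP[jl ul] pT sT eT.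
have [||pT' sub' out' w'] := IH (rcons s j) T _ (sT j) pT.
- by rewrite size_rcons addSnnS.
- by move=> u; apply: eT; exact: mem_head.
set T' := prune _ _ _ _ _ _ _ _ in pT' sub' out' w' *.
have sT' i : rcons s i \in T'.
  rewrite out' ?sT//; apply/negP => /andP[/prefix_rcons_inj/(_ (prefix_refl _)) <-].
  by rewrite eqxx.
have [|pT1 sub1 out1 w1] := IHl T' ul pT' sT'.
  move=> i u il ui; rewrite out'.
    by apply: eT ui; rewrite in_cons il orbT.
  by apply: contra jl => /andP[ju _]; rewrite (prefix_rcons_inj ju ui).
split=> //.
- by move=> u /sub1/sub'.
- move=> u hu; rewrite out1 ?out' ?hu ?mem_head// => i il.
  by apply: hu; rewrite in_cons il orbT.
- move=> i; rewrite in_cons => /predU1P[->|]; last exact: w1.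
  rewrite -w'; apply: eq_weight => u ju; apply: out1 => i' il.
  by apply: contra jl => /andP[iu _]; rewrite (prefix_rcons_inj ju iu).
Qed.

Lemma prune_spec k s (T : {fset string m}) : (size s + k = D)%N ->
  s \in T -> proper_tree T ->
  (forall u, prefix s u -> (u \in T) = (u \in Tmax)) ->
  spec k s T (prune beta Q x M Tmax k s T).
Proof.
have /in_trees[TD pTm] := TMAX_in_trees.
elim: k s T => [|k IH] s T sD sT pT eT.
  have sl : s \in leaves Tmax.
    by rewrite (leaf_deepest TD) -?eT ?prefix_refl// -sD addn0.
  by split=> //=; rewrite (eq_leaves eT) ?prefix_refl// sl -[size s]addn0 sD eqxx.
have ltD : (size s < D)%N by rewrite -sD addnS ltnS leq_addr.
have sle := eq_leaves eT (prefix_refl s).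
rewrite [prune _ _ _ _ _ _ _ _]/=; case: ifPn => sl.
  (* At a leaf of depth less than [D], [p s = 1] reconciles [beta * p s] in [weight] with [beta] in
     [max_weight]. *)
  split=> //=; rewrite -sle sl (ltn_eqF ltD) (@TMAX_leaf_p s s) ?mulr1 -?sle//.
    exact: prefix_refl.
  exact: ltnW.
have Ds : (D - size s)%N = k.+1 by rewrite -sD addKn.
rewrite /Pm Ds Pm_rec_fine ?sD// (Pe_fine (ltnW ltD)) -EFinM eqe.
case: ifPn => cut.
  split.
  - exact: proper_cut.
  - by move=> u; rewrite !inE => /andP[].
  - by move=> u us; rewrite !inE us andbT.
  - rewrite (eqP cut) /= (ltn_eqF ltD) ifT//; exact: leaf_cut.
have [||pT' sub out w] := prune_children IH sD (enum_uniq 'I_m) pT.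
- by move=> j; exact: rcons_in_tree.
- by move=> j u _ /prefix_rconsl/eT.
set T' := foldl _ _ _ in pT' sub out w *.
split=> //.
- move=> u us; apply: out => j _; apply: contra us => /andP[ju _].
  rewrite (prefix_rconsl ju)/=; apply/eqP => us.
  by have := size_prefix ju; rewrite us size_rcons ltnn.
- move: cut; rewrite /= -sle (negbTE sl) => cut.
  (* One surviving child shows that [s] is still internal in [T'], so its weight is the splitting
     term, which is the maximum since the first term does not attain it. *)
  have j0 : 'I_m := Ordinal (ltnW hm).
  have jT' : rcons s j0 \in T'.
    rewrite out ?rcons_in_tree// => i _; apply/negP => /andP[].
    by move=> /prefix_rcons_inj/(_ (prefix_refl _)) ->; rewrite eqxx.
  rewrite ifF; last by apply/negP => /leavesP[_ /(_ j0)]; rewrite jT'.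
  under eq_bigr do rewrite w ?mem_enum//.
  by move: cut; rewrite /Num.max; case: ifP => //; rewrite eqxx.
Qed.

Lemma T1_spec : 0 < beta < 1 -> T1 beta Q x M Tmax \in trees m D /\
  weight D beta p (T1 beta Q x M Tmax) D [::] = max_weight D beta p Tmax D [::].
Proof.
have /in_trees[TD pT] := TMAX_in_trees; have [T0 _ _] := pT.
have [pT1 sub _ w] := prune_spec (erefl D : size [::] + D = D)%N T0 pT (fun _ _ => erefl).
by split=> //; apply/in_trees; split=> // s /sub/TD.
Qed.

Lemma tree_prior_marg_lik (T : {fset string m}) : 0 < beta < 1 -> T \in trees m D ->
  ((tree_prior D beta T)%:E * marg_lik Q x M T = (weight D beta p T D [::])%:E)%E.
Proof.
move=> b01 TT; have /in_trees[TD _] := TT.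
rewrite -(tree_prior_weight p hm b01 TT) [RHS]EFinM -prodEFin marg_likE//.
congr (_ * _)%E.
by rewrite big_seq [RHS]big_seq; apply: eq_bigr => s /leavesP[/TD/Pe_fine].
Qed.

End pruning.

Theorem theorem2 (R : realType) (m D n : nat) (beta : R)
    (c : nat -> R) (Q : R -> 'I_m) (x : (D + n).-tuple R)
    (M : ctx_models R m) (Tmax : {fset string m})
    (hm : (2 <= m)%N) (hn : (1 <= n)%N) (hbeta : 0 < beta < 1)
    (hQ : quantiser c Q)
    (hM : valid_models D Q M)
    (hPe : forall s : string m, (size s <= D)%N -> (Pe Q x M s < +oo)%E)
    (hpx : (0 < evidence beta Q x M < +oo)%E)
    (hTmax : is_TMAX Q x Tmax)
    (hbeta2 : 1 / 2 <= beta) :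
  T1 beta Q x M Tmax \in trees m D /\
  posterior beta Q x M (T1 beta Q x M Tmax) =
    \big[maxe/-oo%E]_(T <- trees m D) posterior beta Q x M T.
Proof.
have [T1in T1w] := T1_spec hm hM hPe hTmax hbeta; split=> //.
have TmaxT := TMAX_in_trees hTmax.
have /in_trees[TD [T0 _ _]] := TmaxT.
(* The pruned tree is itself a candidate, which gives one inequality; for the other, all posteriors
   share the nonnegative factor [evidence^-1], so weights are compared. *)
apply/eqP; rewrite eq_le le_bigmax_seq//= big_seq.
apply: bigmax_le => [|T TT]; first exact: leNye.
rewrite /posterior !(tree_prior_marg_lik hm hM hPe)// T1w.
apply: lee_wpmul2r; first by rewrite inve_ge0; case/andP: hpx => /ltW.
rewrite lee_fin; apply: weight_le_max => //.
- by move=> s sD; rewrite fine_ge0// (Pe_ge0 x hM).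
- exact: (TMAX_leaf_p hM hTmax).
Qed.
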